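(* Let $f:\,]0,\infty[\to\mathbb{R}$ be a strictly convex function with $f(x)\geq 0$ for all $x$ and $f(1)=0$. Let $C\subseteq M_{+}$ be a convex set of measures and let $Q\in M_{+}^{1}$ be a probability measure. If $D_{f}(C,Q)<\infty$, then there exists a bounded measure $Q^{*}\in M_{+}$ such that for every asymptotically optimal sequence $(P_{n})$ in $C$ we have $P_{n}(i)\to Q^{*}(i)$ as $n\to\infty$ for $Q$-almost every $i$. In particular, the measure $Q^{*}$ is unique $Q$-almost surely.
   Context: All measures live on a fixed countable (discrete) set; a measure $P$ is identified with its vector of point masses $p_i=P(i)\geq 0$. $M_{+}$ denotes the set of finite positive measures and $M_{+}^{1}$ the set of probability measures on this set. For a convex $f:\,]0,\infty[\to\mathbb{R}$ with $f\geq 0$ and $f(1)=0$, set $f(0)=\lim_{x\to 0}f(x)$ and $f'(\infty)=\lim_{x\to\infty}f(x)/x$ (both in $[0,\infty]$), with the convention $f\left(\frac{x}{0}\right)\cdot 0=f'(\infty)\cdot x$ (equal to $0$ when $x=0$). For finite measures $P,Q$ the $f$-divergence is $D_{f}(P,Q)=\sum_{i}f\left(\frac{p_{i}}{q_{i}}\right)q_{i}\in[0,\infty]$. For a convex set $C$ of measures, $D_{f}(C,Q)=\inf_{P\in C}D_{f}(P,Q)$. A sequence $P_{n}\in C$ is asymptotically optimal if $D_{f}(P_{n},Q)\to D_{f}(C,Q)$ as $n\to\infty$. *)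

(* Defs.v *)
From HB Require Import structures.
From mathcomp Require Import all_boot all_order all_algebra.
From mathcomp Require Import all_classical all_reals all_analysis.

Set Implicit Arguments.
Unset Strict Implicit.
Unset Printing Implicit Defensive.

Import Order.TTheory GRing.Theory Num.Theory.
Import numFieldNormedType.Exports.

Local Open Scope classical_set_scope.
Local Open Scope ring_scope.
Local Open Scope ereal_scope.

(* A measure on the countable discrete set T is represented by its vector
   T -> R of point masses; [mass p A] is the measure of A. *)
Definition mass (R : realType) (T : countType) (p : T -> R) (A : set T) :
  \bar R := \esum_(i in A) (p i)%:E.

(* M_+ *)
Definition fin_measure (R : realType) (T : countType) : set (T -> R) :=
  [set p | (forall i, (0 <= p i)%R) /\ mass p setT < +oo].

(* M_+^1 *)
Definition prob_measure (R : realType) (T : countType) : set (T -> R) :=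
  [set p | (forall i, (0 <= p i)%R) /\ mass p setT = 1].

Definition almost_every (R : realType) (T : countType) (q : T -> R)
  (A : T -> Prop) : Prop := mass q [set i | ~ A i] = 0.

(* Functions on ]0, +oo[ are represented by functions on R whose values
   outside ]0, +oo[ are never used. *)
Definition strictly_convex_pos (R : realType) (f : R -> R) : Prop :=
  forall x y t : R, (0 < x)%R -> (0 < y)%R -> x != y -> (0 < t < 1)%R ->
    (f (t * x + (1 - t) * y) < t * f x + (1 - t) * f y)%R.

(* The limits below exist in [0, +oo] when f is convex on ]0, +oo[, f >= 0
   and f 1 = 0, so [lim] never takes its default value there. *)
Definition f_at0 (R : realType) (f : R -> R) : \bar R :=
  lim ((f x)%:E @[x --> 0%R^'+]).

Definition f_slope_oo (R : realType) (f : R -> R) : \bar R :=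
  lim ((f x / x)%:E @[x --> +oo%R]).

Definition f_ext (R : realType) (f : R -> R) (x : R) : \bar R :=
  if x == 0%R then f_at0 f else (f x)%:E.

(* f (p / q) * q, read as f'(oo) * p when q = 0; note that +oo * 0 = 0. *)
Definition fdiv_term (R : realType) (f : R -> R) (p q : R) : \bar R :=
  if q == 0%R then f_slope_oo f * p%:E else f_ext f (p / q) * q%:E.

Definition fdiv (R : realType) (T : countType) (f : R -> R) (P Q : T -> R) :
  \bar R := \esum_(i in [set: T]) fdiv_term f (P i) (Q i).

Definition fdiv_inf (R : realType) (T : countType) (f : R -> R)
  (C : set (T -> R)) (Q : T -> R) : \bar R :=
  ereal_inf [set fdiv f P Q | P in C].

Definition convex_measures (R : realType) (T : countType)
  (C : set (T -> R)) : Prop := @convex_set R (T -> R^o) C.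

Definition asymptotically_optimal (R : realType) (T : countType) (f : R -> R)
  (C : set (T -> R)) (Q : T -> R) (P : nat -> T -> R) : Prop :=
  (forall n, C (P n)) /\ fdiv f (P n) Q @[n --> \oo] --> fdiv_inf f C Q.

Definition asymptotic_limit (R : realType) (T : countType) (f : R -> R)
  (C : set (T -> R)) (Q Qs : T -> R) : Prop :=
  forall P : nat -> T -> R, asymptotically_optimal f C Q P ->
    almost_every Q (fun i => P n i @[n --> \oo] --> Qs i).

(* Main.v *)
Require Import Defs.
From HB Require Import structures.
From mathcomp Require Import all_boot all_order all_algebra.
From mathcomp Require Import all_classical all_reals all_analysis.
From mathcomp Require Import lra ring.
Set Implicit Arguments.
Unset Strict Implicit.
Unset Printing Implicit Defensive.

Import Order.TTheory GRing.Theory Num.Theory.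
Import numFieldNormedType.Exports.
Local Open Scope classical_set_scope.
Local Open Scope ring_scope.

(* Fix i with Q i > 0.  The i-th term of the divergence is strictly convex in
   P i, uniformly so on bounded sets, and f grows at least linearly, so P i is
   bounded on the set of near-optimal P.  If A and B in C are near-optimal and
   A i, B i stay apart, then the midpoint of A and B, which lies in C, has a
   divergence smaller than the infimum.  Hence any two asymptotically optimal
   sequences are close to each other at i, each is Cauchy there, and they have
   the same limit.  Linear growth of f and Fatou's lemma bound the mass of the
   limit. *)

(** * Chord slopes and midpoint gaps of convex functions *)

Definition chord (R : realType) (g : R -> R) (x y : R) : R :=
  (g y - g x) / (y - x).

(** Twice the Jensen defect of [g] at the midpoint. *)
Definition midgap (R : realType) (g : R -> R) (x y : R) : R :=
  g x + g y - 2 * g ((x + y) / 2).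

(** Convexity of [g] on [D] in three-slope form. Only the leftmost point is tested against [D],
    which will be the upward closed set [f_dom f]. *)
Definition chord_mono (R : realType) (g : R -> R) (D : set R) : Prop :=
  forall x y z, D x -> x < y -> y < z -> chord g x y <= chord g y z.

(** The slope over [x, z] is a weighted mean of the slopes over [x, y] and [y, z]. *)
Lemma chord_trans (R : realType) (g : R -> R) (x y z : R) :
  x < y -> y < z -> chord g x y <= chord g y z ->
  chord g x y <= chord g x z <= chord g y z.
Proof.
move=> xy yz; rewrite /chord.
have xy0 : 0 < y - x by lra. have yz0 : 0 < z - y by lra.
have xz0 : 0 < z - x by lra.
rewrite ler_pdivrMr // mulrAC ler_pdivlMr // => h.
by apply/andP; split; rewrite ler_pdivrMr // mulrAC ler_pdivlMr //; lra.
Qed.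

Lemma midgap_ge0 (R : realType) (g : R -> R) (D : set R) (x y : R) :
  chord_mono g D -> D x -> x < y -> 0 <= midgap g x y.
Proof.
move=> gD Dx xy.
have := gD x ((x + y) / 2) y Dx ltac:(lra) ltac:(lra).
rewrite /chord (_ : (x + y) / 2 - x = (y - x) / 2); last by lra.
rewrite (_ : y - (x + y) / 2 = (y - x) / 2); last by lra.
by rewrite ler_pM2r ?invr_gt0 /midgap; lra.
Qed.

(** The endpoints move one at a time, [x] to [u] and then [y] to [v]. The midpoint moves half as far
    as the endpoint, and monotonicity of slopes compares the two increments of [g]. *)
Lemma midgapS (R : realType) (g : R -> R) (D : set R) (x u v y : R) :
  chord_mono g D -> (forall a b, D a -> a < b -> D b) -> D x ->
  x < u -> u < v -> v < y -> midgap g u v <= midgap g x y.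
Proof.
move=> gD Dup Dx xu uv vy.
pose m := (x + y) / 2; pose m' := (u + y) / 2; pose m'' := (u + v) / 2.
have Du : D u by exact: Dup xu.
have Dm'' : D m'' by apply: (Dup _ _ Du); rewrite /m''; lra.
have Dm : D m by apply: (Dup _ _ Dx); rewrite /m; lra.
have Dv : D v by exact: Dup uv.
have half (a b : R) (k : R) : 0 < k -> a / k <= b / (k / 2) -> a <= 2 * b.
  move=> k0; rewrite ler_pdivrMr // mulrAC ler_pdivlMr ?divr_gt0 // => h.
  by rewrite -(ler_pM2r (x := k / 2)); [lra|rewrite divr_gt0].
have half' (a b : R) (k : R) : 0 < k -> a / (k / 2) <= b / k -> 2 * a <= b.
  move=> k0; rewrite ler_pdivrMr ?divr_gt0 // mulrAC ler_pdivlMr // => h.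
  by rewrite -(ler_pM2r (x := k / 2)); [lra|rewrite divr_gt0].
have left : g u - g x <= 2 * (g m' - g m).
  apply: (@half _ _ (u - x)); first by lra.
  rewrite -(_ : m' - m = (u - x) / 2); last by rewrite /m /m'; lra.
  rewrite -/(chord g x u) -/(chord g m m').
  have um' : u < m' by rewrite /m'; lra.
  have xm : x < m by rewrite /m; lra.
  have mm' : m < m' by rewrite /m /m'; lra.
  (* The slope over [x, m'] is the intermediary, whatever the order of [u] and [m]. *)
  have /andP[+ _] := chord_trans xu um' (gD _ _ _ Dx xu um').
  have /andP[_ +] := chord_trans xm mm' (gD _ _ _ Dx xm mm').
  by move=> /[swap]; exact: le_trans.
have right : 2 * (g m' - g m'') <= g y - g v.
  apply: (@half' _ _ (y - v)); first by lra.
  rewrite -(_ : m' - m'' = (y - v) / 2); last by rewrite /m'' /m'; lra.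
  rewrite -/(chord g m'' m') -/(chord g v y).
  have m'y : m' < y by rewrite /m'; lra.
  have mv : m'' < v by rewrite /m''; lra.
  have mm' : m'' < m' by rewrite /m'' /m'; lra.
  have /andP[+ _] := chord_trans mm' m'y (gD _ _ _ Dm'' mm' m'y).
  have /andP[_ +] := chord_trans mv vy (gD _ _ _ Dm'' mv vy).
  by move=> /[swap]; exact: le_trans.
by rewrite /midgap -/m -/m''; lra.
Qed.

Lemma min_pos (R : realType) (G : nat -> R) (N : nat) :
  (forall k, 0 < G k) -> exists2 e, 0 < e & forall k, (k < N)%N -> e <= G k.
Proof.
move=> G0; elim: N => [|N [e e0 eG]]; first by exists 1.
exists (Num.min e (G N)); first by rewrite lt_min e0 G0.
move=> k; rewrite ltnS leq_eqVlt => /predU1P[->|kN]; rewrite ge_min ?lexx ?orbT //.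
by rewrite eG.
Qed.

(* Shrinking an interval decreases the midpoint gap, so that the gap over
   [x, y] dominates that over a cell of a fixed finite grid avoiding 0. *)
Lemma midgap_unif (R : realType) (g : R -> R) (D : set R) (K e : R) :
  chord_mono g D -> (forall a b, D a -> a < b -> D b) ->
  (forall x, D x -> 0 <= x) ->
  (forall x y, 0 < x -> x < y -> 0 < midgap g x y) -> 0 < e ->
  exists2 eta, 0 < eta & forall x y, D x -> x + e <= y -> y <= K ->
    eta <= midgap g x y.
Proof.
(* If kd <= x < (k+1)d, then (k+2)d <= x + e/2 < y, so the cell from (k+1)d to (k+2)d lies strictly
   between [x] and [y]. Its left end is at least [d], and x <= K leaves finitely many k. *)
move=> gD Dup D0 gpos e0; pose d := e / 4.
have d0 : 0 < d by rewrite divr_gt0.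
have [|eta eta0 etaG] :=
  @min_pos R (fun k => midgap g (k.+1%:R * d) (k.+2%:R * d)) (Num.trunc (K / d)).+1.
  by move=> k; rewrite gpos ?mulr_gt0 // ltr_pM2r // ltr_nat.
exists eta => // x y Dx xy yK; have x0 := D0 _ Dx.
pose k := Num.trunc (x / d).
have /andP[k1 k2] : k%:R <= x / d < k.+1%:R by rewrite truncn_itv ?divr_ge0 // ltW.
have := k1; rewrite ler_pdivlMr // => k1'.
have := k2; rewrite ltr_pdivrMr // => k2'.
apply: le_trans (etaG k _) _.
  by rewrite ltnS le_truncn // ler_pM2r ?invr_gt0 //; lra.
have k3 : k.+1%:R * d = k%:R * d + d by rewrite -natr1 mulrDl mul1r.
have k4 : k.+2%:R * d = k%:R * d + 2 * d by rewrite -addn2 natrD mulrDl.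
by apply: (midgapS _ Dup) => //; rewrite ?k3 ?k4 /d in k1' k2' *; lra.
Qed.

(** * Slopes and growth of [f], extended to 0 *)

Lemma strict_chord (R : realType) (f : R -> R) (x y z : R) :
  strictly_convex_pos f -> 0 < x -> x < y -> y < z ->
  chord f x y < chord f y z.
Proof.
move=> fC x0 xy yz; pose t := (z - y) / (z - x).
have xz : 0 < z - x by lra.
have t01 : 0 < t < 1 by rewrite divr_gt0 ?ltr_pdivrMr //; lra.
have tE : t * (z - x) = z - y by rewrite divfK // gt_eqF.
have ty : t * x + (1 - t) * z = y by lra.
have := fC x z t x0 ltac:(lra) ltac:(lra) t01; rewrite ty.
rewrite -(ltr_pM2r xz).
have -> : (t * f x + (1 - t) * f z) * (z - x) = (z - y) * f x + (y - x) * f z.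
  by rewrite -{1}tE (_ : y - x = (1 - t) * (z - x)); [ring|lra].
move=> h; rewrite /chord ltr_pdivrMr ?subr_gt0 // mulrAC.
by rewrite ltr_pdivlMr ?subr_gt0 //; lra.
Qed.

(** The minimum 0 of [f] is attained at 1, so the slope over [y, 1] is at most 0, and slopes
    increase to the right. *)
Lemma nonincreasing_01 (R : realType) (f : R -> R) (x y : R) :
  strictly_convex_pos f -> (forall x, 0 < x -> 0 <= f x) -> f 1 = 0 ->
  0 < x -> x <= y -> y <= 1 -> f y <= f x.
Proof.
move=> fC f0 f1 x0; rewrite le_eqVlt => /predU1P[->//|xy].
rewrite le_eqVlt => /predU1P[->|y1]; first by rewrite f1 f0.
have : chord f x y < 0.
  apply: lt_le_trans (strict_chord fC x0 xy y1) _.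
  by rewrite /chord f1 sub0r mulNr oppr_le0 divr_ge0 ?f0 //; lra.
by rewrite /chord pmulr_llt0 ?invr_gt0 ?subr_gt0 // subr_lt0 => /ltW.
Qed.

(** Monotonicity on ]0, 1] makes the limit at 0 exist in the extended reals, so [lim] is a true
    limit there and inherits lower bounds. *)
Lemma le_f_at0 (R : realType) (f : R -> R) (x : R) :
  strictly_convex_pos f -> (forall x, 0 < x -> 0 <= f x) -> f 1 = 0 ->
  0 < x -> x <= 1 -> ((f x)%:E <= f_at0 f)%E.
Proof.
move=> fC f0 f1 x0 x1; apply: lime_ge.
  apply: nonincreasing_at_right_is_cvge; near=> b => u v.
  rewrite !in_itv /= => /andP[u0 ub] /andP[v0 vb] uv; rewrite lee_fin.
  apply: nonincreasing_01 => //; apply: le_trans (ltW vb) _.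
  by near: b; apply: nbhs_right_le.
near=> u; rewrite lee_fin; apply: nonincreasing_01 => //.
by near: u; exact: nbhs_right_le.
Unshelve. all: by end_near. Qed.

Lemma f_ext_pos (R : realType) (f : R -> R) (x : R) :
  0 < x -> f_ext f x = (f x)%:E.
Proof. by move=> x0; rewrite /f_ext gt_eqF. Qed.

Lemma f_ext_ge0 (R : realType) (f : R -> R) (x : R) :
  strictly_convex_pos f -> (forall x, 0 < x -> 0 <= f x) -> f 1 = 0 ->
  0 <= x -> (0 <= f_ext f x)%E.
Proof.
move=> fC f0 f1; rewrite le_eqVlt => /predU1P[<-|x0].
  rewrite /f_ext eqxx; apply: le_trans (le_f_at0 fC f0 f1 ltr01 _) => //.
  by rewrite f1.
by rewrite f_ext_pos // lee_fin f0.
Qed.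

Lemma f_slope_oo_ge0 (R : realType) (f : R -> R) :
  (forall x, 0 < x -> 0 <= f x) -> (0 <= f_slope_oo f)%E.
Proof.
move=> f0; rewrite /f_slope_oo.
(* In the divergent case [lim] is the default point, which is nonnegative. *)
have [c|/dvgP -> //] := pselect (cvg ((f x / x)%:E @[x --> +oo])).
apply: lime_ge => //; near=> x; rewrite lee_fin.
have x0 : 0 < x by near: x; exact: nbhs_pinfty_gt.
by rewrite divr_ge0 ?f0 // ltW.
Unshelve. all: by end_near. Qed.

(** Either [0, +oo[ or ]0, +oo[, according to whether [f_at0 f] is below +oo. *)
Definition f_dom (R : realType) (f : R -> R) : set R :=
  [set x | 0 <= x /\ (f_ext f x < +oo)%E].

(* Meaningful on [f_dom f] only: if [f_at0 f] is +oo, then [fine] gives the junk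
   value 0 at 0. *)
Definition f_fin (R : realType) (f : R -> R) (x : R) : R := fine (f_ext f x).

Lemma f_fin_pos (R : realType) (f : R -> R) (x : R) :
  0 < x -> f_fin f x = f x.
Proof. by move=> x0; rewrite /f_fin f_ext_pos. Qed.

Lemma f_dom_up (R : realType) (f : R -> R) (x y : R) :
  f_dom f x -> x < y -> f_dom f y.
Proof.
move=> [x0 _] xy; have y0 := le_lt_trans x0 xy.
by split; [exact: ltW|rewrite f_ext_pos // ltry].
Qed.

Lemma chord_mono_f_fin (R : realType) (f : R -> R) :
  strictly_convex_pos f -> (forall x, 0 < x -> 0 <= f x) -> f 1 = 0 ->
  chord_mono (f_fin f) (f_dom f).
Proof.
move=> fC f0 f1 x y z [+ Dx] xy yz.
rewrite le_eqVlt => /predU1P[x0|x0]; last first.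
  rewrite /chord !f_fin_pos //; try lra.
  by apply: ltW; exact: strict_chord.
subst x; rewrite /chord !subr0 (f_fin_pos f xy) (f_fin_pos f (lt_trans xy yz)).
set F := f_fin f 0.
have FE : F%:E = f_at0 f.
  rewrite /F /f_fin fineK; first by rewrite /f_ext eqxx.
  by rewrite ge0_fin_numE // f_ext_ge0.
rewrite ler_pdivrMr // mulrAC ler_pdivlMr ?subr_gt0 //.
rewrite leNgt; apply/negP => h.
(* The chord inequality on [x', z] tends to that on [0, z] as x' -> 0. *)
pose A := (f y - F) * (z - y) - (f z - f y) * y.
have A0 : 0 < A by rewrite /A; lra.
pose B := `|f z - f y| + 1.
have B0 : 0 < B by rewrite /B ltr_wpDl.
(* [A] is the margin by which the inequality fails on [0, z]. With x' B <= A, moving the left end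
   from 0 to [x'] costs less than this margin; x' <= y / 2 keeps [x'] left of [y], and x' <= 1 gives
   f x' <= F. *)
pose x' := Num.min (A / B) (Num.min (y / 2) 1).
have x'0 : 0 < x' by rewrite /x' !lt_min !divr_gt0 ?ltr01.
have x'A : x' * B <= A by rewrite -ler_pdivlMr // /x' ge_min lexx.
have x'y : x' <= y / 2 by rewrite /x' !ge_min lexx orbT.
have x'1 : x' <= 1 by rewrite /x' !ge_min lexx !orbT.
clearbody x'; have x'ly : x' < y by lra.
have := le_f_at0 fC f0 f1 x'0 x'1; rewrite -FE lee_fin => fF.
have := strict_chord fC x'0 x'ly yz.
rewrite /chord ltr_pdivrMr ?subr_gt0 //.
rewrite mulrAC ltr_pdivlMr ?subr_gt0 // => h2.
have := ler_norm (- (f z - f y)); rewrite normrN => nB.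
have : (f y - F) * (z - y) <= (f y - f x') * (z - y).
  by rewrite ler_pM2r ?subr_gt0 //; lra.
have : x' * (- (f z - f y)) < x' * B by rewrite ltr_pM2l // /B; lra.
by rewrite /A in x'A A0; lra.
Qed.

Lemma midgap_f_fin (R : realType) (f : R -> R) (x y : R) :
  strictly_convex_pos f -> 0 < x -> x < y -> 0 < midgap (f_fin f) x y.
Proof.
move=> fC x0 xy; rewrite /midgap !f_fin_pos; try lra.
have := fC x y 2^-1 x0 ltac:(lra) ltac:(lra) ltac:(lra).
by rewrite (_ : 2^-1 * x + (1 - 2^-1) * y = (x + y) / 2); lra.
Qed.

(** Strict convexity gives 0 <= f (3/2) < f 2 / 2, so the slope [f 2] over [1, 2] is positive.
    Slopes beyond 2 exceed it, whence the constant 1 / f 2; the summand 2 covers x <= 2. *)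
Lemma f_linear_lower (R : realType) (f : R -> R) :
  strictly_convex_pos f -> (forall x, 0 < x -> 0 <= f x) -> f 1 = 0 ->
  exists2 c, 0 < c & forall x, f_dom f x -> x <= 2 + c * f_fin f x.
Proof.
move=> fC f0 f1.
have f2 : 0 < f 2.
  have := fC 1 3 2^-1 ltac:(lra) ltac:(lra) ltac:(lra) ltac:(lra).
  rewrite (_ : 2^-1 * 1 + (1 - 2^-1) * 3 = 2); last by lra.
  have := f0 2 ltac:(lra); have := f0 (3 / 2) ltac:(lra).
  have := fC 1 2 2^-1 ltac:(lra) ltac:(lra) ltac:(lra) ltac:(lra).
  by rewrite (_ : 2^-1 * 1 + (1 - 2^-1) * 2 = 3 / 2); lra.
exists (f 2)^-1; rewrite ?invr_gt0 // => x [x0 Dx].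
have fx0 : 0 <= f_fin f x by apply: fine_ge0; exact: f_ext_ge0.
have [x2|x2] := leP x 2; first by rewrite -[leLHS]addr0 lerD ?mulr_ge0 ?invr_ge0 // ltW.
rewrite f_fin_pos; last by lra.
have := strict_chord fC ltr01 (y := 2) ltac:(lra) x2.
rewrite /chord f1 subr0 (_ : 2 - 1 = 1); last by lra.
rewrite divr1 ltr_pdivlMr ?subr_gt0 // => h.
rewrite -lerBlDl mulrC ler_pdivlMr //; lra.
Qed.

(** * Single terms of the divergence *)

Lemma midgapC (R : realType) (g : R -> R) (x y : R) :
  midgap g x y = midgap g y x.
Proof. by rewrite /midgap [g x + _]addrC [x + y]addrC. Qed.

Lemma midgapxx (R : realType) (g : R -> R) (x : R) : midgap g x x = 0.
Proof. by rewrite /midgap (_ : (x + x) / 2 = x); lra. Qed.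

Lemma f_dom_mid (R : realType) (f : R -> R) (x y : R) :
  f_dom f x -> f_dom f y -> f_dom f ((x + y) / 2).
Proof.
wlog: x y / x <= y => [h Dx Dy|].
  by case/orP: (le_total x y) => ?; [|rewrite addrC]; apply: h.
rewrite le_eqVlt => /predU1P[->|xy Dx _]; first by rewrite (_ : (y + y) / 2 = y) //; lra.
by apply: (f_dom_up Dx); lra.
Qed.

Lemma fdiv_term_ge0 (R : realType) (f : R -> R) (p q : R) :
  strictly_convex_pos f -> (forall x, 0 < x -> 0 <= f x) -> f 1 = 0 ->
  0 <= p -> 0 <= q -> (0 <= fdiv_term f p q)%E.
Proof.
move=> fC f0 f1 p0 q0; rewrite /fdiv_term; case: ifP => _.
  by rewrite mule_ge0 ?lee_fin ?f_slope_oo_ge0.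
by rewrite mule_ge0 ?lee_fin // f_ext_ge0 // divr_ge0.
Qed.

Lemma fdiv_term_fin (R : realType) (f : R -> R) (p q : R) :
  strictly_convex_pos f -> (forall x, 0 < x -> 0 <= f x) -> f 1 = 0 ->
  0 <= p -> 0 < q -> (fdiv_term f p q < +oo)%E -> f_dom f (p / q).
Proof.
move=> fC f0 f1 p0 q0; have pq0 : 0 <= p / q by rewrite divr_ge0 // ltW.
rewrite /fdiv_term gt_eqF // => h; split => //.
rewrite ltey; apply/eqP => E.
by move: h; rewrite E gt0_mulye ?lte_fin // ltxx.
Qed.

Lemma fdiv_term_dom (R : realType) (f : R -> R) (p q : R) :
  strictly_convex_pos f -> (forall x, 0 < x -> 0 <= f x) -> f 1 = 0 ->
  0 < q -> f_dom f (p / q) -> fdiv_term f p q = (f_fin f (p / q) * q)%:E.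
Proof.
move=> fC f0 f1 q0 [pq0 D]; rewrite /fdiv_term gt_eqF // EFinM /f_fin fineK //.
by rewrite ge0_fin_numE // f_ext_ge0.
Qed.

(** For q = 0 the term is linear in its first argument. For q > 0, either the right side is +oo or
    both ratios lie in [f_dom f], where the midpoint gap is nonnegative. The doubled form avoids
    halving extended reals. *)
Lemma fdiv_term_mid (R : realType) (f : R -> R) (a b q : R) :
  strictly_convex_pos f -> (forall x, 0 < x -> 0 <= f x) -> f 1 = 0 ->
  0 <= a -> 0 <= b -> 0 <= q ->
  (fdiv_term f ((a + b) / 2) q + fdiv_term f ((a + b) / 2) q
    <= fdiv_term f a q + fdiv_term f b q)%E.
Proof.
move=> fC f0 f1 a0 b0; rewrite le_eqVlt => /predU1P[<-|q0].
  have m0 : 0 <= (a + b) / 2 by rewrite divr_ge0 ?addr_ge0.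
  by rewrite /fdiv_term eqxx -!ge0_muleDr ?lee_fin // -!EFinD -splitr.
have tge p : 0 <= p -> (fdiv_term f p q != -oo)%E.
  by move=> p0; rewrite gt_eqF // (lt_le_trans ltNy0) // fdiv_term_ge0 // ltW.
have [->|] := eqVneq (fdiv_term f a q) +oo%E; first by rewrite addye ?tge // leey.
rewrite -ltey => /(fdiv_term_fin fC f0 f1 a0 q0) Da.
have [->|] := eqVneq (fdiv_term f b q) +oo%E; first by rewrite addey ?tge // leey.
rewrite -ltey => /(fdiv_term_fin fC f0 f1 b0 q0) Db.
have mE : (a + b) / 2 / q = (a / q + b / q) / 2 by ring.
have Dm := f_dom_mid Da Db; rewrite -mE in Dm.
rewrite !fdiv_term_dom // -!EFinD lee_fin -!mulrDl ler_pM2r // mE.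
have := chord_mono_f_fin fC f0 f1; set g := f_fin f => gD.
suff : 0 <= midgap g (a / q) (b / q) by rewrite /midgap; lra.
have [ab|ab|->] := ltgtP (a / q) (b / q); last by rewrite midgapxx.
  exact: midgap_ge0 gD Da ab.
by rewrite midgapC; exact: midgap_ge0 gD Db ab.
Qed.

(** Linear growth of [f], scaled by [q]. It bounds both a single coordinate of a near-optimal
    measure and, after summation, the mass of the limit. *)
Lemma fdiv_term_lower (R : realType) (f : R -> R) :
  strictly_convex_pos f -> (forall x, 0 < x -> 0 <= f x) -> f 1 = 0 ->
  exists2 c, 0 < c & forall p q, 0 <= p -> 0 < q ->
    (p%:E <= (2 * q)%:E + c%:E * fdiv_term f p q)%E.
Proof.
move=> fC f0 f1; have [c c0 h] := f_linear_lower fC f0 f1.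
exists c => // p q p0 q0.
have [->|] := eqVneq (fdiv_term f p q) +oo%E.
  by rewrite gt0_muley ?lte_fin // addey // leey.
rewrite -ltey => /(fdiv_term_fin fC f0 f1 p0 q0) Dp.
rewrite fdiv_term_dom // -EFinM -EFinD lee_fin mulrA -mulrDl.
by rewrite -ler_pdivrMr // h.
Qed.

(** Terms of size at most [M] confine the ratios to a bounded interval, by linear growth, and there
    the midpoint gap of points at distance at least e / q has a uniform positive lower bound. *)
Lemma fdiv_term_gap (R : realType) (f : R -> R) (q M e : R) :
  strictly_convex_pos f -> (forall x, 0 < x -> 0 <= f x) -> f 1 = 0 ->
  0 < q -> 0 < e ->
  exists2 eta, 0 < eta & forall a b, 0 <= a -> 0 <= b ->
    (fdiv_term f a q <= M%:E)%E -> (fdiv_term f b q <= M%:E)%E ->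
    e <= `|a - b| ->
    (fdiv_term f ((a + b) / 2) q + fdiv_term f ((a + b) / 2) q + eta%:E
      <= fdiv_term f a q + fdiv_term f b q)%E.
Proof.
move=> fC f0 f1 q0 e0; have [c c0 lower] := fdiv_term_lower fC f0 f1.
have gD := chord_mono_f_fin fC f0 f1.
have [|eta eta0 h] := @midgap_unif R (f_fin f) (f_dom f) ((2 * q + c * M) / q)
  (e / q) gD (@f_dom_up R f) (fun x Dx => Dx.1)
  (fun x y => @midgap_f_fin R f x y fC); first by rewrite divr_gt0.
have bnd p : 0 <= p -> (fdiv_term f p q <= M%:E)%E ->
    f_dom f (p / q) /\ p / q <= (2 * q + c * M) / q.
  move=> p0 pM; split; first by exact: fdiv_term_fin (le_lt_trans pM (ltry _)).
  rewrite ler_pM2r ?invr_gt0 // -lee_fin.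
  apply: le_trans (lower p q p0 q0) _.
  by rewrite [leRHS]EFinD leeD2l // EFinM lee_pmul2l ?lte_fin.
(* The factor [q] turns a gap between values of [f] at ratios into a gap between terms. *)
exists (eta * q); first by rewrite mulr_gt0.
move=> a b a0 b0 /(bnd _ a0)[Da aK] /(bnd _ b0)[Db bK] ab.
have mE : (a + b) / 2 / q = (a / q + b / q) / 2 by ring.
have Dm := f_dom_mid Da Db; rewrite -mE in Dm.
rewrite !fdiv_term_dom // -!EFinD lee_fin -!mulrDl ler_pM2r // mE.
suff : eta <= midgap (f_fin f) (a / q) (b / q) by rewrite /midgap; lra.
move: ab; have [ab|ab] := lerP a b => eab.
  by apply: h => //; rewrite -mulrDl ler_pM2r ?invr_gt0 //; lra.
by rewrite midgapC; apply: h => //; rewrite -mulrDl ler_pM2r ?invr_gt0 //; lra.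
Qed.

(** * Sums over [T], midpoints in [C] and null sets *)

(** Carries a gain at one coordinate over to the whole divergence, by splitting off the index
    [i]. *)
Lemma le_esum_gap (R : realType) (T : choiceType) (u v : T -> \bar R) (i : T)
    (eta : R) :
  (forall j, 0 <= u j)%E -> (forall j, u j <= v j)%E -> 0 <= eta ->
  (u i + eta%:E <= v i)%E ->
  (\esum_(j in [set: T]) u j + eta%:E <= \esum_(j in [set: T]) v j)%E.
Proof.
move=> u0 uv eta0 h; have v0 j : (0 <= v j)%E by exact: le_trans (uv j).
rewrite (esumID [set i] setT u) // (esumID [set i] setT v) // !setTI.
rewrite !esum_set1 // addeAC leeD // le_esum // => j _; exact: uv.
Qed.

Lemma fdiv_ge0 (R : realType) (T : countType) (f : R -> R) (P Q : T -> R) :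
  strictly_convex_pos f -> (forall x, 0 < x -> 0 <= f x) -> f 1 = 0 ->
  (forall i, 0 <= P i) -> (forall i, 0 <= Q i) -> (0 <= fdiv f P Q)%E.
Proof. by move=> fC f0 f1 P0 Q0; apply: esum_ge0 => i _; exact: fdiv_term_ge0. Qed.

Lemma fdiv_term_le_fdiv (R : realType) (T : countType) (f : R -> R)
    (P Q : T -> R) (i : T) :
  strictly_convex_pos f -> (forall x, 0 < x -> 0 <= f x) -> f 1 = 0 ->
  (forall i, 0 <= P i) -> (forall i, 0 <= Q i) ->
  (fdiv_term f (P i) (Q i) <= fdiv f P Q)%E.
Proof.
move=> fC f0 f1 P0 Q0; have t0 j := fdiv_term_ge0 fC f0 f1 (P0 j) (Q0 j).
rewrite /fdiv (esumID [set i]) // setTI esum_set1 // leeDl // esum_ge0 //.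
Qed.

Lemma convex_measures_mid (R : realType) (T : countType) (C : set (T -> R))
    (A B : T -> R) :
  convex_measures C -> C A -> C B -> C (fun i => (A i + B i) / 2).
Proof.
move=> cC CA CB.
have h0 : 0 <= 2^-1 :> R by lra.
have h1 : 2^-1 <= 1 :> R by lra.
have /set_mem := cC A B (Itv01 h0 h1) (mem_set CA) (mem_set CB).
congr (C _); apply/funext => i.
change (2^-1 * A i + (1 - 2^-1) * B i = (A i + B i) / 2); lra.
Qed.

Lemma esumZ_le (R : realType) (T : choiceType) (c : R) (a : T -> \bar R) :
  0 <= c -> (forall i, 0 <= a i)%E ->
  (\esum_(i in [set: T]) (c%:E * a i) <= c%:E * \esum_(i in [set: T]) a i)%E.
Proof.
move=> c0 a0; apply: ge_ereal_sup => _ [X fX <-].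
rewrite -ge0_mule_fsumr // lee_wpmul2l ?lee_fin //.
by apply: esum_ge; exists X.
Qed.

(** A sum of nonnegative terms is the supremum of its finite partial sums, and limits pass through
    each of these. *)
Lemma esum_fatou (R : realType) (T : choiceType) (u : nat -> T -> \bar R)
    (l : T -> \bar R) (M : \bar R) :
  (forall n i, 0 <= u n i)%E -> (forall i, u n i @[n --> \oo] --> l i) ->
  (\forall n \near \oo, (\esum_(i in [set: T]) u n i <= M)%E) ->
  (\esum_(i in [set: T]) l i <= M)%E.
Proof.
move=> u0 ul uM; apply: ge_ereal_sup => _ [X [finX XT] <-].
rewrite fsbig_finite //.
have h : \sum_(i <- finmap.enum_fset (fset_set X)) u n i @[n --> \oo] -->
    (\sum_(i <- finmap.enum_fset (fset_set X)) l i)%E.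
  by apply: cvg_nnesum => i _ //; exact: nearW.
rewrite -(cvg_lim (@ereal_hausdorff R) h); apply: lime_le; first by apply/cvg_ex; eexists; exact: h.
near=> n; apply: le_trans (_ : \esum_(i in [set: T]) u n i <= M)%E; last first.
  by near: n.
by apply: esum_ge; exists X => //; rewrite fsbig_finite.
Unshelve. all: by end_near. Qed.

(** Reduces almost-everywhere claims to a fixed atom, where the gap estimate applies. *)
Lemma almost_everyP (R : realType) (T : countType) (q : T -> R) (A : T -> Prop) :
  (forall i, 0 <= q i) -> almost_every q A <-> forall i, 0 < q i -> A i.
Proof.
move=> q0; split => [h i qi|h].
  apply: contrapT => nA.
  have : ((q i)%:E <= mass q [set j | ~ A j])%E.
    apply: esum_ge; exists [set i]; last by rewrite fsbig_set1.
    by split; [exact: finite_set1|move=> _ ->].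
  by rewrite h lee_fin leNgt qi.
apply: esum1 => i /= nA; congr (_%:E); apply/eqP; move: (q0 i).
by rewrite le_eqVlt => /predU1P[<-//|/h].
Qed.

(** * Near-optimal measures and their limit *)

Lemma near_optimal_close (R : realType) (T : countType) (f : R -> R)
    (C : set (T -> R)) (Q : T -> R) (i : T) (e : R) :
  strictly_convex_pos f -> (forall x, 0 < x -> 0 <= f x) -> f 1 = 0 ->
  C `<=` @fin_measure R T -> convex_measures C -> (forall j, 0 <= Q j) ->
  fdiv_inf f C Q \is a fin_num -> 0 < Q i -> 0 < e ->
  exists2 eta, 0 < eta & forall A B, C A -> C B ->
    (fdiv f A Q <= fdiv_inf f C Q + eta%:E)%E ->
    (fdiv f B Q <= fdiv_inf f C Q + eta%:E)%E -> `|A i - B i| < e.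
Proof.
move=> fC f0 f1 CM cC Q0; set d := fdiv_inf f C Q => dfin Qi e0.
have [eta eta0 gap] := fdiv_term_gap (fine d + 1) fC f0 f1 Qi e0.
(* The bound 1 keeps each term below the level [fine d + 1] for which [eta] was chosen. The bound
   eta / 4 makes the two excesses add up to at most eta / 2, while the midpoint would gain [eta]. *)
exists (Num.min 1 (eta / 4)); first by rewrite lt_min ltr01 divr_gt0.
set eta' := Num.min _ _.
have eta'1 : eta' <= 1 by rewrite /eta' ge_min lexx.
have eta'4 : eta' <= eta / 4 by rewrite /eta' ge_min lexx orbT.
move=> A B CA CB dA dB; have [A0 _] := CM _ CA; have [B0 _] := CM _ CB.
rewrite ltNge; apply/negP => eAB.
have term P : (forall j, 0 <= P j) -> (fdiv f P Q <= d + eta'%:E)%E ->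
    (fdiv_term f (P i) (Q i) <= (fine d + 1)%:E)%E.
  move=> P0 dP; apply: le_trans (fdiv_term_le_fdiv i fC f0 f1 P0 Q0) _.
  by apply: le_trans dP _; rewrite EFinD fineK // leeD2l.
have gapi := gap _ _ (A0 i) (B0 i) (term _ A0 dA) (term _ B0 dB) eAB.
pose m j := (A j + B j) / 2.
have m0 j : 0 <= m j by rewrite /m divr_ge0 ?addr_ge0.
have t0 P j : (forall k, 0 <= P k) -> (0 <= fdiv_term f (P j) (Q j))%E.
  by move=> P0; exact: fdiv_term_ge0.
have dm : (d <= fdiv f m Q)%E.
  by apply: ereal_inf_lbound; exists m => //; exact: convex_measures_mid.
have : (fdiv f m Q + fdiv f m Q + eta%:E <= fdiv f A Q + fdiv f B Q)%E.
  rewrite /fdiv -!esumD => [|*|*|*|*]; try exact: t0.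
  apply: (@le_esum_gap R T _ _ i) => //; last exact: ltW.
    by move=> j; rewrite adde_ge0 // t0.
  by move=> j; exact: fdiv_term_mid.
move=> h; have : (d + d + eta%:E <= (d + eta'%:E) + (d + eta'%:E))%E.
  apply: le_trans (leeD dA dB); apply: le_trans h.
  by rewrite leeD2r // leeD.
by rewrite -(fineK dfin) -!EFinD lee_fin; lra.
Qed.

Lemma near_le_add (R : realType) (u : nat -> \bar R) (d : \bar R) (eta : R) :
  d \is a fin_num -> u n @[n --> \oo] --> d -> 0 < eta ->
  \forall n \near \oo, (u n <= d + eta%:E)%E.
Proof.
move=> dfin + eta0; rewrite -{1}(fineK dfin) => /fine_cvgP[ufin /cvgrPdist_lt].
move=> /(_ _ eta0) h; near=> n.
have un : u n \is a fin_num by near: n.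
rewrite -(fineK un) -(fineK dfin) -EFinD lee_fin.
have : `|fine d - (fine \o u) n| < eta by near: n.
by rewrite /= ltr_norml => /andP[]; lra.
Unshelve. all: by end_near. Qed.

Theorem theorem6 (R : realType) (T : countType) (f : R -> R)
    (f_convex : strictly_convex_pos f)
    (f_ge0 : forall x : R, 0 < x -> 0 <= f x)
    (f1 : f 1 = 0)
    (C : set (T -> R)) (CM : C `<=` @fin_measure R T)
    (C_convex : convex_measures C)
    (Q : T -> R) (Q_prob : prob_measure Q)
    (finD : (fdiv_inf f C Q < +oo)%E) :
  exists Qs : T -> R,
    [/\ fin_measure Qs,
        asymptotic_limit f C Q Qs
      & forall Q' : T -> R, fin_measure Q' -> asymptotic_limit f C Q Q' ->
          almost_every Q (fun i => Q' i = Qs i)].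
Proof.
have [Q0 Q1] := Q_prob.
have dfin : fdiv_inf f C Q \is a fin_num.
  rewrite ge0_fin_numE //; apply: le_ereal_inf_tmp => _ [P /CM[P0 _] <-].
  exact: fdiv_ge0.
have close i e := near_optimal_close f_convex f_ge0 f1 CM C_convex Q0 dfin
  (i := i) (e := e).
(* An infimum below +oo is taken over a nonempty set and has a minimizing sequence; [Qs] is read off
   from this one. *)
have [P optP] : exists P, asymptotically_optimal f C Q P.
  have [|u Cu ud] := @ereal_inf_seq R [set fdiv f P Q | P in C].
    by have [x Sx _] := ereal_inf_lt finD; apply/set0P; exists x.
  have /choice[P hP] n : exists P, C P /\ fdiv f P Q = u n.
    by have [P CP <-] := Cu n; exists P.
  exists P; split => [n|]; first by have [] := hP n.
  by rewrite (_ : (fun n => fdiv f (P n) Q) = u) //; apply/funext => n; have [] := hP n.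
have [CP cvP] := optP; have P0 n i : 0 <= P n i by have [] := CM _ (CP n).
have nearP (P' : nat -> T -> R) eta : asymptotically_optimal f C Q P' -> 0 < eta ->
    \forall n \near \oo, (fdiv f (P' n) Q <= fdiv_inf f C Q + eta%:E)%E.
  by move=> [_ cvP'] eta0; exact: near_le_add.
(* Where [Q i] vanishes the sequence is not controlled, so the value is set to 0 to keep the mass
   finite. *)
pose Qs i : R := if Q i == 0 then 0 else lim (P n i @[n --> \oo]).
have limP i : 0 < Q i -> P n i @[n --> \oo] --> Qs i.
  (* Cauchy: all late terms lie within [e] of [P N i], because [P N] and [P n] are both
     near-optimal. *)
  move=> Qi; rewrite /Qs gt_eqF //; apply: cauchy_cvg; apply: cauchy_exP => e e0.
  have [eta eta0 h] := close i e Qi e0.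
  have nP := nearP P eta optP eta0; have [N _ hN] := nP.
  exists (P N i).
  change (\forall n \near \oo, ball (P N i) e (P n i)).
  near=> n; rewrite /= -ball_normE /=; apply: h => //.
    exact: (hN N (leqnn N)).
  by near: n.
have allP : asymptotic_limit f C Q Qs.
  move=> P' optP'; apply/almost_everyP => // i Qi.
  have [CP' _] := optP'.
  (* Late terms of [P'] and [P] are near-optimal together, so their difference at [i] tends to 0. *)
  apply: cvg_sub0 (limP i Qi); apply/cvgr0Pnorm_lt => e e0.
  have [eta eta0 h] := close i e Qi e0.
  by near=> n; apply: h => //; near: n; exact: nearP.
exists Qs; split => //.
- have Qs0 i : 0 <= Qs i.
    rewrite /Qs; case: eqP => // /eqP Qi; apply: limr_ge; last exact: nearW.
    apply/cvg_ex; eexists; apply: limP; by rewrite lt_neqAle eq_sym Qi Q0.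
  split=> //.
  have [c c0 lower] := fdiv_term_lower f_convex f_ge0 f1.
  (* Truncated to the atoms of [Q], so that it converges to [Qs] everywhere and [lower] applies
     wherever it is nonzero. *)
  pose u n i := if Q i == 0 then 0%E else (P n i)%:E.
  (* Summing [lower] gives twice the mass 1 of [Q] plus [c] times the divergence, which is
     eventually at most the infimum plus 1. *)
  have : (mass Qs setT <= 1 + 1 + c%:E * (fdiv_inf f C Q + 1%:E))%E.
    apply: (@esum_fatou _ _ u).
    + by move=> n i; rewrite /u; case: ifP; rewrite ?lee_fin.
    + move=> i; rewrite /u; have [Qi|Qi] := eqVneq (Q i) 0.
        by rewrite /Qs Qi eqxx; exact: cvg_cst.
      by apply: cvg_EFin; [exact: nearW|apply: limP; rewrite lt_neqAle eq_sym Qi Q0].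
    near=> n; have t0 i := fdiv_term_ge0 f_convex f_ge0 f1 (P0 n i) (Q0 i).
    apply: (@le_trans _ _ (\esum_(i in setT)
      ((Q i)%:E + (Q i)%:E + c%:E * fdiv_term f (P n i) (Q i)))%E).
      apply: le_esum => i _; rewrite /u; case: eqP => [_|/eqP Qi].
        by rewrite !adde_ge0 ?mule_ge0 ?lee_fin // ltW.
      have Qi0 : 0 < Q i by rewrite lt_neqAle eq_sym Qi Q0.
      apply: le_trans (lower _ _ (P0 n i) Qi0) _.
      by rewrite -EFinD (_ : Q i + Q i = 2 * Q i) //; ring.
    have Q0' i : (0 <= (Q i)%:E)%E by rewrite lee_fin.
    have ct0 i : (0 <= c%:E * fdiv_term f (P n i) (Q i))%E.
      by rewrite mule_ge0 // lee_fin ltW.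
    rewrite !esumD => [|i _|i _|i _|i _] //; last exact: adde_ge0.
    rewrite -/(mass Q setT) Q1 leeD //.
    apply: le_trans (esumZ_le (ltW c0) t0) _.
    rewrite lee_wpmul2l ?lee_fin ?(ltW c0) //.
    by near: n; exact: nearP.
  move=> /le_lt_trans; apply.
  by rewrite -(fineK dfin); exact: (ltry (1 + 1 + c * (fine (fdiv_inf f C Q) + 1))).
- move=> Q' _ limQ'; apply/almost_everyP => // i Qi.
  have /almost_everyP - /(_ Q0 i Qi) h := limQ' P optP.
  exact: cvg_unique h (limP i Qi).
Unshelve. all: by end_near. Qed.
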